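(* Let $\delta\in(0,1]$ and let $(p_n)_{n\ge 1}$ be a sequence in $[0,1]$. Consider the anisotropic long-range percolation model with parameters $\delta$ and $(p_n)_{n\geq 1}$ on the graph $G^{an}$ with vertex set $\mathbb{Z}^2$, and its truncations $P^K$, $K\in\{1,2,\dots\}$. If there exists an integer $N>0$ such that $\sum_{n=1}^{\infty} p_n p_{n+N}=\infty$, then $$\lim_{K\to\infty}P^K\{(0,0)\leftrightarrow\infty\}=1.$$
   Context: The graph $G^{an}=(\mathbb{Z}^2,\mathbb{E}^{an})$ is the unoriented graph with vertex set $\mathbb{Z}^2$ and set of bonds $\mathbb{E}^{an}=\mathbb{E}^v\cup\left(\bigcup_{n\ge1}\mathbb{E}^h_n\right)$, where $\mathbb{E}^v=\{\langle x,x+(0,1)\rangle : x\in\mathbb{Z}^2\}$ is the set of nearest-neighbour vertical bonds and $\mathbb{E}^h_n=\{\langle x,x+(n,0)\rangle : x\in\mathbb{Z}^2\}$ is the set of horizontal bonds of length $n$. The anisotropic percolation model with parameters $\delta$ and $(p_n)_{n\ge1}$ is the product probability measure $P$ on $\{0,1\}^{\mathbb{E}^{an}}$ under which the bonds are independently open (value $1$) or closed (value $0$), each bond in $\mathbb{E}^v$ being open with probability $\delta$ and each bond in $\mathbb{E}^h_n$ being open with probability $p_n$. For a positive integer $K$, the truncated measure $P^K$ is the product measure defined in the same way with the same $\delta$ but with $(p_n)_n$ replaced by $(p_n^K)_n$, where $p_n^K=p_n$ if $n\le K$ and $p_n^K=0$ if $n>K$. The event $\{(0,0)\leftrightarrow\infty\}$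 is the set of configurations in which there exists an infinite (self-avoiding) path of open bonds starting from $(0,0)$. *)

(* Defs.v *)
From HB Require Import structures.
From mathcomp Require Import all_boot all_order all_algebra.
From mathcomp Require Import all_classical all_reals all_analysis.

Set Implicit Arguments.
Unset Strict Implicit.
Unset Printing Implicit Defensive.

Import Order.TTheory GRing.Theory Num.Theory.

Local Open Scope classical_set_scope.
Local Open Scope ring_scope.

Definition site : Type := (int * int)%type.

Definition origin : site := (0, 0).

(* Each unoriented bond is named once, by its lower (resp. left) endpoint x:
   [Vbond x] is <x, x + (0,1)> and [Hbond m x] is <x, x + (m+1, 0)>; the shift
   by one makes the lengths of horizontal bonds range exactly over n >= 1. *)
Inductive bond : Type :=
| Vbond of site
| Hbond of nat & site.

Definition bond_code (e : bond) : site + nat * site :=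
  match e with Vbond x => inl x | Hbond m x => inr (m, x) end.

Definition bond_decode (c : site + nat * site) : bond :=
  match c with inl x => Vbond x | inr (m, x) => Hbond m x end.

Lemma bond_codeK : cancel bond_code bond_decode.
Proof. by case. Qed.

#[warning="-redundant-canonical-projection"]
HB.instance Definition _ := Countable.copy bond (can_type bond_codeK).

Definition bond_start (e : bond) : site :=
  match e with Vbond x => x | Hbond _ x => x end.

Definition bond_end (e : bond) : site :=
  match e with
  | Vbond x => (x.1, x.2 + 1)
  | Hbond m x => (x.1 + m.+1%:Z, x.2)
  end.

Definition joins (e : bond) (x y : site) : Prop :=
  (bond_start e = x /\ bond_end e = y) \/ (bond_start e = y /\ bond_end e = x).

Definition cylinders : set (set (bond -> bool)) :=
  [set C | exists (e : bond) (b : bool), C = [set w | w e = b]].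

(* {0,1}^E with the product sigma-algebra; [true] means open *)
Notation config := (g_sigma_algebraType cylinders).

Definition bond_prob (R : realType) (delta : R) (p : nat -> R) (e : bond) : R :=
  match e with Vbond _ => delta | Hbond m _ => p m.+1 end.

(* [P] is the product over all bonds of the Bernoulli laws of parameters
   [bond_prob delta p]; the values on finite-dimensional cylinders determine a
   probability on [config]. *)
Definition percolation_measure (R : realType) (delta : R) (p : nat -> R)
    (P : probability config R) : Prop :=
  forall (s : seq bond) (b : bond -> bool), uniq s ->
    P [set w : config | forall e, e \in s -> w e = b e] =
    (\prod_(e <- s) (if b e then bond_prob delta p e
                     else 1 - bond_prob delta p e))%:E.

Definition truncation (R : realType) (K : nat) (p : nat -> R) (n : nat) : R :=
  if (n <= K)%N then p n else 0.

Definition percolates : set config :=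
  [set w | exists f : nat -> site,
    [/\ f 0%N = origin, injective f &
        forall k, exists2 e : bond, joins e (f k) (f k.+1) & w e = true]].

(* Vertices have infinite degree, so existence of an infinite self-avoiding open
   path is an analytic condition on w, which need not lie in the product
   sigma-algebra. Under a truncated measure almost every open subgraph is
   locally finite, and by Koenig's lemma [percolates] then differs from a
   measurable set by a null set. Hence events are evaluated under the completion
   of P, which agrees with P on measurable sets. *)
Definition completed_prob (R : realType) (P : probability config R)
    (A : set config) : \bar R :=
  @completed_measure_extension _ _ _ P A.

(* Main.v *)
Require Import Defs.
From mathcomp Require Import all_boot all_order all_algebra.
From mathcomp Require Import all_classical all_reals all_analysis.
From mathcomp Require Import zify ring lra.

(** Why the theorem holds.

    Going right by [n + N] and then left by [n] is a step of length [N].  Let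
    [T] be a finite set of values of [n] disjoint from its translate by [N].  The
    detours with [n] in [T] between the consecutive points of a progression of
    common difference [N] use disjoint sets of bonds, so the sublattice of
    columns at multiples of [N] has independent horizontal links, each missing
    with probability the product of the [1 - p n * p (n + N)] over [T]
    ([column_bonds_inj], [pr_unlinked]).  By divergence of the series, split into
    two classes of lengths ([sparse_lengths]), this product can be made as small
    as desired, and [T] is contained in the lengths allowed by all but finitely
    many truncations.

    Group [M] consecutive links of a row with the [M] vertical bonds above them
    into a block.  It is good when all its links are present and one of its
    vertical bonds is open.  Adjacent good blocks are connected, distinct blocks
    are independent, and a block is bad with probability at most
    [M * prod + (1 - delta) ^ M], which is small for a suitable [M] and then a
    suitable [T] ([pr_bad_block]).

    It remains to see that the origin percolates with probability close to one
    when blocks are bad with small probability [eta].  This is done by a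
    multiscale argument.  A cell of level [n + 1] is a 3 by 3 array of cells of
    level [n], good when at most one of them is bad.  Removing one cell from a 3
    by 3 grid leaves it connected, and does so compatibly with adjacent grids, so
    the good blocks surviving at all scales inside a good cell form one cluster
    ([core_connected]).  A bad cell contains two independent bad subcells, so
    badness decreases at least geometrically with the level ([pr_bad]), and with
    probability at least [1 - 2 * eta] the cells at the origin are good at every
    level.  The cluster of the origin is then infinite, it lives in a locally
    finite graph, and Koenig's lemma extracts a self-avoiding path ([koenig],
    [good_percolates]). *)

Set Implicit Arguments.
Unset Strict Implicit.
Unset Printing Implicit Defensive.

Import Order.TTheory GRing.Theory Num.Theory numFieldNormedType.Exports.

Local Open Scope classical_set_scope.
Local Open Scope ring_scope.

(** * Reachability and Koenig's lemma *)

Definition reach (T : eqType) (e : rel T) (x y : T) : Prop :=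
  exists2 p, path e x p & last x p = y.

Lemma reach_refl (T : eqType) (e : rel T) x : reach e x x.
Proof. by exists [::]. Qed.

Lemma reach_edge (T : eqType) (e : rel T) x y : e x y -> reach e x y.
Proof. by move=> exy; exists [:: y] => //=; rewrite exy. Qed.

Lemma reach_trans (T : eqType) (e : rel T) x y z :
  reach e x y -> reach e y z -> reach e x z.
Proof.
move=> [p pp <-] [q qq <-]; exists (p ++ q); last by rewrite last_cat.
by rewrite cat_path pp.
Qed.

Lemma reach_sym (T : eqType) (e : rel T) x y :
  symmetric e -> reach e x y -> reach e y x.
Proof.
move=> es [p pp <-]; exists (rev (belast x p)).
  by rewrite rev_path; apply: sub_path pp => a b /=; rewrite es.
by case: p pp => //= a p _; rewrite rev_cons last_rcons.
Qed.

Section Koenig.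
Variables (T : choiceType) (e : rel T) (nb : T -> seq T).
Hypothesis e_nb : forall x y, e x y -> y \in nb x.

Definition reach_avoiding (V : seq T) (x : T) : set T :=
  [set y | exists p, [/\ path e x p, last x p = y, uniq (x :: p) &
                         all (fun z => z \notin V) (x :: p)]].

(** A state of the construction is a list of used vertices together with a
    current vertex from which infinitely many vertices remain accessible off
    that list.  Accessibility is witnessed by duplicate-free paths, so the tail
    of a witness automatically avoids the vertex being left, and finiteness of
    the neighbourhood forces one neighbour to inherit infinitely many targets. *)
Lemma koenig_step V x : infinite_set (reach_avoiding V x) ->
  exists2 x', e x x' & infinite_set (reach_avoiding (x :: V) x').
Proof.
move=> inf; apply: contrapT => nostep; apply: inf.
apply: (@sub_finite_set _ _
  ([set x] `|` \bigcup_(x' in [set x' | x' \in nb x /\ e x x'])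
     reach_avoiding (x :: V) x')).
  move=> y [[|x' p] /= [pp ply up ap]]; first by left.
  right; move: pp => /andP[exx' pp]; exists x' => /=; first by split; [exact: e_nb|].
  exists p; split => //; first by move: up => /andP[].
  apply/allP => z zp; have zV : z \notin V.
    by have /andP[_ aV] := ap; exact: (@allP _ (fun z => z \notin V) (x' :: p) aV).
  rewrite inE negb_or zV andbT; apply: contraTneq zp => ->.
  by move: up => /andP[].
rewrite finite_setU; split; first exact: finite_set1.
apply: bigcup_finite.
  apply: (@sub_finite_set _ _ [set` nb x]) => [z []//|].
  exact: finite_seq.
by move=> x' /= [_ exx']; apply: contrapT => inf'; apply: nostep; exists x'.
Qed.

(** Iterating the step gives a path whose every vertex is off the list of its
    predecessors, hence an injective one. *)
Lemma koenig x0 : infinite_set [set y | reach e x0 y] ->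
  exists f : nat -> T,
    [/\ f 0%N = x0, injective f & forall k, e (f k) (f k.+1)].
Proof.
move=> inf.
pose St := {s : seq T * T | infinite_set (reach_avoiding s.1 s.2)}.
have inf0 : infinite_set (reach_avoiding [::] x0).
  move=> fin; apply: inf; apply: sub_finite_set fin => y /= [p pp <-].
  case/shortenP: pp => p' pp' up' _; exists p'; split => //.
  exact/allP.
pose nxt (s t : St) :=
  e (sval s).2 (sval t).2 /\ (sval t).1 = (sval s).2 :: (sval s).1.
have [s|h [h0 hS]] := @dependent_choice St nxt _ (exist _ ([::], x0) inf0).
  case: s => -[V x] /= iVx.
  have [x' exx' iVx'] := cid2 (koenig_step iVx).
  by exists (exist _ (x :: V, x') iVx').
pose f k := (sval (h k)).2; pose V k := (sval (h k)).1.
have fV k : f k \notin V k.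
  rewrite /f /V; case: (h k) => -[V' x'] /= inf'.
  apply/negP => xV; apply: inf'; apply: (@sub_finite_set _ _ set0) => //.
  by move=> y [p [_ _ _ /= /andP[]]]; rewrite xV.
have VS k : V k.+1 = f k :: V k by case: (hS k).
have fVlt i k : (i < k)%N -> f i \in V k.
  elim: k => // k IH; rewrite ltnS leq_eqVlt VS inE => /orP[/eqP->|/IH ->].
    by rewrite eqxx.
  by rewrite orbT.
exists f; split.
- by rewrite /f h0.
- move=> i k fik; case: (ltngtP i k) => // lt.
    by have := fVlt _ _ lt; rewrite fik (negbTE (fV k)).
  by have := fVlt _ _ lt; rewrite -fik (negbTE (fV i)).
- by move=> k; case: (hS k).
Qed.
End Koenig.

(** * Good cells at all scales *)

Section Renormalization.
Local Open Scope nat_scope.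

Definition cell : Type := (nat * nat)%type.
Definition offsets : seq cell :=
  [:: (0, 0); (0, 1); (0, 2); (1, 0); (1, 1); (1, 2); (2, 0); (2, 1); (2, 2)].
Definition subcell (c d : cell) : cell := (3 * c.1 + d.1, 3 * c.2 + d.2).

(** A cell of level [n] is a square of [3 ^ n] by [3 ^ n] cells of level [0].
    Tolerating one bad subcell out of nine makes badness quadratic in the
    badness one level below, and still leaves good subcells connected. *)
Fixpoint good (g : pred cell) (n : nat) : pred cell := fun c =>
  if n is n'.+1 then count (fun d => ~~ good g n' (subcell c d)) offsets <= 1
  else g c.

(** The core of a cell consists of the level-[0] cells all of whose ancestors,
    up to the given cell, are good. *)
Fixpoint in_core (g : pred cell) (n : nat) (c x : cell) : bool :=
  if n is n'.+1 then
    good g n c && has (fun d => in_core g n' (subcell c d) x) offsets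
  else g c && (x == c).

Definition adj (c c' : cell) : bool :=
  (c' == (c.1.+1, c.2)) || (c' == (c.1, c.2.+1)).

(** One step of breadth-first search in the 3 by 3 grid restricted to [f]. *)
Definition spread (f : pred cell) (S : seq cell) : seq cell :=
  [seq d <- offsets | f d && ((d \in S) || has (fun s => adj s d || adj d s) S)].

(** Subsets of the 3 by 3 grid, coded as bit sequences so that the connectivity
    of the grid minus one cell can be checked by evaluation. *)
Definition of_mask (m : seq bool) : pred cell :=
  fun d => nth false m (index d offsets).

Fixpoint masks (n : nat) : seq (seq bool) :=
  if n is n'.+1 then
    [seq true :: m | m <- masks n'] ++ [seq false :: m | m <- masks n']
  else [:: [::]].

Lemma mem_masks (m : seq bool) : m \in masks (size m).
Proof.
elim: m => //= b m IH; rewrite mem_cat.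
by case: b; rewrite (map_f _ IH) ?orbT.
Qed.

(** Four steps suffice: with the centre present every remaining cell is within
    distance two of it, and without it the other eight cells form a cycle, whose
    diameter is four. *)
Lemma spread_cover (m : seq bool) : size m = 9 ->
  count (predC (of_mask m)) offsets <= 1 ->
  {subset [seq d <- offsets | of_mask m d] <=
     iter 4 (spread (of_mask m))
     [:: if of_mask m (1, 1) then (1, 1) else (0, 0)]}.
Proof.
move=> m9; have := mem_masks m; rewrite m9 => mm cnt; apply/allP.
pose check m := if count (predC (of_mask m)) offsets <= 1 then
  let S := iter 4 (spread (of_mask m))
    [:: if of_mask m (1, 1) then (1, 1) else (0, 0)] in
  all (mem S) [seq d <- offsets | of_mask m d] else true.
have : all check (masks 9) by vm_compute.
by move=> /allP /(_ _ mm); rewrite /check cnt.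
Qed.

(** By search from the centre, or from a corner when the centre is missing.
    Transitivity of [Q] is only asked through cells of [f], because [Q] will be a
    relation between cores, and a core is known to be nonempty only for a good
    cell. *)
Lemma grid_connected (f : pred cell) (Q : cell -> cell -> Prop) :
  count (predC f) offsets <= 1 ->
  (forall d, f d -> Q d d) ->
  (forall c d, Q c d -> Q d c) ->
  (forall c d d', f d -> Q c d -> Q d d' -> Q c d') ->
  (forall c d, c \in offsets -> d \in offsets -> f c -> f d -> adj c d -> Q c d) ->
  {in offsets &, forall c d, f c -> f d -> Q c d}.
Proof.
move=> cnt Qrefl Qsym Qtrans Qadj.
pose r := if f (1, 1) then (1, 1) else (0, 0).
have [fr ro] : f r /\ r \in offsets.
  rewrite /r; case: ifP => [|/negbT f11]; first by split.
  split=> //; apply: contraTT cnt => f00; rewrite -ltnNge /=; lia.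
have spreadP S : {in S, forall d, f d /\ d \in offsets /\ Q d r} ->
    {in spread f S, forall d, f d /\ d \in offsets /\ Q d r}.
  move=> HS d; rewrite mem_filter => /andP[/andP[fd /orP[/HS//|/hasP[s sS ds]]] dof].
  have [fs [sof sr]] := HS s sS.
  split=> //; split=> //; apply: Qtrans sr => //.
  by case/orP: ds => ad; [apply: Qsym|]; apply: Qadj.
have iterP k : {in iter k (spread f) [:: r],
    forall d, f d /\ d \in offsets /\ Q d r}.
  elim: k => [|k IH]; last exact: spreadP.
  by move=> d; rewrite inE => /eqP ->; split=> //; split=> //; exact: Qrefl.
have cover : {subset [seq d <- offsets | f d] <= iter 4 (spread f) [:: r]}.
  pose f' := of_mask [seq f d | d <- offsets].
  have ff' : {in offsets, f =1 f'}.
    by move=> d dof; rewrite /f' /of_mask (nth_map (0,0)) ?index_mem// nth_index.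
  have cnt' : count (predC f') offsets <= 1.
    rewrite -(@eq_in_count _ (predC f)) // => d dof.
    by rewrite /= (ff' d dof).
  have := @spread_cover [seq f d | d <- offsets] erefl cnt'.
  rewrite -/f' -(ff' (1, 1) isT) -/r -(eq_in_filter ff').
  have -> // : iter 4 (spread f') [:: r] = iter 4 (spread f) [:: r].
  by elim: (4) => // k IH; rewrite !iterS IH.
have toR d : d \in offsets -> f d -> Q d r.
  move=> dof fd; have dit : d \in iter 4 (spread f) [:: r].
    by apply: cover; rewrite mem_filter fd.
  by have [_ []] := iterP _ _ dit.
move=> c d cof dof fc fd; apply: (Qtrans _ r) => //; first exact: toR.
by apply: Qsym; exact: toR.
Qed.

Lemma core_good g n c x : in_core g n c x -> good g n c.
Proof. by case: n => [|n] /= /andP[]. Qed.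

Lemma in_coreS g n c x : in_core g n.+1 c x =
  good g n.+1 c && has (fun d => in_core g n (subcell c d) x) offsets.
Proof. by []. Qed.

Lemma goodS g n c : good g n.+1 c =
  (count (fun d => ~~ good g n (subcell c d)) offsets <= 1).
Proof. by []. Qed.

Lemma good_or g n c d d' : good g n.+1 c ->
  d \in offsets -> d' \in offsets -> d != d' ->
  good g n (subcell c d) || good g n (subcell c d').
Proof.
move=> gc dof d'of dd'; apply: contraTT gc; rewrite negb_or => /andP[bd bd'].
rewrite goodS -ltnNge -size_filter.
apply: (@uniq_leq_size _ [:: d; d']); first by rewrite /= inE dd'.
by move=> x; rewrite !inE mem_filter => /orP[]/eqP->; apply/andP.
Qed.

Lemma bad_pair g n c : ~~ good g n.+1 c ->
  exists d d', [/\ d \in offsets, d' \in offsets, d != d',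
    ~~ good g n (subcell c d) & ~~ good g n (subcell c d')].
Proof.
rewrite goodS -ltnNge -size_filter.
pose s := [seq d <- offsets | ~~ good g n (subcell c d)]; rewrite -/s => s2.
have us : uniq s by apply: filter_uniq.
have : {subset s <= [pred d | (d \in offsets) && ~~ good g n (subcell c d)]}.
  by move=> d; rewrite mem_filter inE andbC.
case: s us s2 => [|d [|d' s]] //= us _ sub; exists d, d'.
have := sub d; rewrite !inE eqxx => /(_ isT) /andP[-> ->].
have := sub d'; rewrite !inE eqxx orbT => /(_ isT) /andP[-> ->].
by split=> //; move: us; rewrite inE negb_or -andbA => /andP[].
Qed.

Lemma good_core g n c : good g n c -> exists x, in_core g n c x.
Proof.
elim: n c => [|n IH] c gc; first by exists c; rewrite /= eqxx andbT.
have := good_or gc (d := (0, 0)) (d' := (0, 1)) isT isT isT.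
by case/orP=> /IH[x hx]; exists x; rewrite in_coreS gc; apply/hasP;
  [exists (0, 0)|exists (0, 1)].
Qed.

Lemma adjE c c' : adj c c' -> c' = (c.1.+1, c.2) \/ c' = (c.1, c.2.+1).
Proof. by case/orP => /eqP ->; [left|right]. Qed.

Lemma two_of_three (a0 a1 a2 b0 b1 b2 : bool) :
  a0 || a1 -> a0 || a2 -> a1 || a2 -> b0 || b1 -> b0 || b2 -> b1 || b2 ->
  [\/ a0 && b0, a1 && b1 | a2 && b2].
Proof.
move: a0 a1 a2 b0 b1 b2 => [] [] [] [] [] [] // *;
  first [exact: Or31 | exact: Or32 | exact: Or33].
Qed.

(** Three pairs of subcells face each other across the common side of two
    adjacent cells; each cell spoils at most one of these pairs. *)
Lemma good_adj_subcells g n c c' : adj c c' -> good g n.+1 c -> good g n.+1 c' ->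
  exists d d', [/\ d \in offsets, d' \in offsets, good g n (subcell c d),
    good g n (subcell c' d') & adj (subcell c d) (subcell c' d')].
Proof.
move=> cc' gc gc'.
have key (s t : nat -> cell) :
    (forall j, j < 3 -> s j \in offsets /\ t j \in offsets) ->
    injective s -> injective t ->
    (forall j, adj (subcell c (s j)) (subcell c' (t j))) ->
    exists d d', [/\ d \in offsets, d' \in offsets, good g n (subcell c d),
      good g n (subcell c' d') & adj (subcell c d) (subcell c' d')].
  move=> sto sI tI st.
  have [s0 t0] := sto 0 isT; have [s1 t1] := sto 1 isT; have [s2 t2] := sto 2 isT.
  have [] := two_of_three
    (good_or gc s0 s1 _) (good_or gc s0 s2 _) (good_or gc s1 s2 _)
    (good_or gc' t0 t1 _) (good_or gc' t0 t2 _) (good_or gc' t1 t2 _);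
    rewrite ?(inj_eq sI) ?(inj_eq tI) // => /andP[gs gt].
  - by exists (s 0), (t 0).
  - by exists (s 1), (t 1).
  - by exists (s 2), (t 2).
case: (adjE cc') => c'E.
- apply: (key (fun j => (2, j)) (fun j => (0, j))); try by move=> ? ? [].
    by case=> [|[|[]]].
  move=> j; rewrite c'E /adj /subcell /=; apply/orP; left; apply/eqP.
  by clear; congr pair; lia.
- apply: (key (fun j => (j, 2)) (fun j => (j, 0))); try by move=> ? ? [].
    by case=> [|[|[]]].
  move=> j; rewrite c'E /adj /subcell /=; apply/orP; right; apply/eqP.
  by clear; congr pair; lia.
Qed.

Section Cluster.
(* [Q] is the connection relation between level-0 cells. *)
Variables (g : pred cell) (Q : cell -> cell -> Prop).
Hypothesis Qrefl : forall c, Q c c.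
Hypothesis Qsym : forall c d, Q c d -> Q d c.
Hypothesis Qtrans : forall d c c', Q c d -> Q d c' -> Q c c'.
Hypothesis Qadj : forall c d, g c -> g d -> adj c d -> Q c d.

(** A good cell carries a single cluster, shared with its good neighbours.  The
    two halves go up one level together: the first through connectivity of the
    punctured grid and the second half below, the second through a facing pair
    of good subcells. *)
Lemma core_connected n :
  (forall c x y, in_core g n c x -> in_core g n c y -> Q x y) /\
  (forall c c' x y, adj c c' -> in_core g n c x -> in_core g n c' y -> Q x y).
Proof.
elim: n => [|n [IHsame IHadj]].
  split=> [c x y /= /andP[_ /eqP->] /andP[_ /eqP->]//|].
  by move=> c c' x y cc' /= /andP[gc /eqP->] /andP[gc' /eqP->]; exact: Qadj.
have same c x y : in_core g n.+1 c x -> in_core g n.+1 c y -> Q x y.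
  rewrite !in_coreS => /andP[gc /hasP[d dof hx]] /andP[_ /hasP[d' d'of hy]].
  pose QQ d d' := forall x y, in_core g n (subcell c d) x ->
    in_core g n (subcell c d') y -> Q x y.
  have conn : {in offsets &, forall d d', good g n (subcell c d) ->
      good g n (subcell c d') -> QQ d d'}.
    apply: (@grid_connected (fun d => good g n (subcell c d)) QQ gc).
    - by move=> d0 _; exact: IHsame.
    - by move=> c0 d0 H a b ha hb; apply: Qsym; exact: H.
    - move=> c0 d0 d1 /good_core[z hz] H1 H2 a b ha hb.
      by apply: (Qtrans (d := z)); [exact: H1|exact: H2].
    - move=> c0 d0 _ _ _ _ ad a b; apply: IHadj.
      by clear -ad; move: ad => /adjE[]->; rewrite /adj /subcell /=; apply/orP;
         [left|right]; apply/eqP; congr pair; lia.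
  exact: (conn d d' dof d'of (core_good hx) (core_good hy)).
split=> // c c' x y cc' hx hy.
have [d [d' [dof d'of gd gd' dd']]] :=
  good_adj_subcells cc' (core_good hx) (core_good hy).
have [a ha] := good_core gd; have [b hb] := good_core gd'.
have Ha : in_core g n.+1 c a.
  by rewrite in_coreS (core_good hx); apply/hasP; exists d.
have Hb : in_core g n.+1 c' b.
  by rewrite in_coreS (core_good hy); apply/hasP; exists d'.
apply: Qtrans (same _ _ _ Hb hy); apply: Qtrans (same _ _ _ hx Ha) _.
exact: IHadj dd' ha hb.
Qed.

Lemma core_lower_bound n c x : in_core g n c x -> c.1 * 3 ^ n <= x.1.
Proof.
elim: n c => [|n IH] c; first by move=> /= /andP[_ /eqP->]; rewrite muln1.
rewrite in_coreS => /andP[_ /hasP[d _ /IH]]; apply: leq_trans.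
by rewrite expnS mulnA leq_mul2r /=; apply/orP; right; lia.
Qed.

(** If the level-[n] cells at the origin are all good then the origin is in all
    their cores.  One of the two subcells [(2, 0)], [(2, 1)] of the cell of level
    [m + 1] is good, and its core lies at abscissa at least [2 * 3 ^ m]. *)
Lemma good_unbounded : (forall n, good g n (0, 0)) ->
  forall m, exists2 x, Q (0, 0) x & m <= x.1.
Proof.
move=> good0 m.
have h0 n : in_core g n (0, 0) (0, 0).
  elim: n => [|n IH]; first by have /= := good0 0; rewrite eqxx andbT.
  by rewrite in_coreS good0; apply/hasP; exists (0, 0).
have [d d2 gd] : exists2 d, d \in [:: (2, 0); (2, 1)] & good g m (subcell (0, 0) d).
  have := good_or (good0 m.+1) (d := (2, 0)) (d' := (2, 1)) isT isT isT.
  by case/orP; [exists (2, 0)|exists (2, 1)].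
have [x hx] := good_core gd; exists x.
  apply: (proj1 (core_connected m.+1)) (h0 _) _.
  rewrite in_coreS good0; apply/hasP; exists d => //.
  by move: d2; rewrite !inE => /orP[]/eqP->.
apply: leq_trans (core_lower_bound hx).
have -> : (subcell (0, 0) d).1 = 2 by move: d2; rewrite !inE => /orP[]/eqP->.
have := @ltn_expl 3 m isT; lia.
Qed.
End Cluster.

End Renormalization.

(** * Independence of events with disjoint finite supports *)

Definition depends (s : seq bond) (A : set config) : Prop :=
  forall w w' : bond -> bool, {in s, w =1 w'} -> A w -> A w'.

Definition force (e : bond) (b : bool) (w : bond -> bool) : bond -> bool :=
  fun e' => if e' == e then b else w e'.

(** The event [A] read after resetting the state of [e] to [b]: it no longer
    depends on [e], which allows induction on supports. *)
Definition slice (e : bond) (b : bool) (A : set config) : set config :=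
  [set w | A (force e b w)].

Lemma forceE e b (w : bond -> bool) : w e = b -> force e b w = w.
Proof. by move=> <-; apply/funext => e'; rewrite /force; case: eqP => [->|]. Qed.

Lemma depends_slice e b s A : depends (e :: s) A -> depends s (slice e b A).
Proof.
move=> dA w w' ww'; apply: dA => e'; rewrite inE /force.
by case: eqP => //= _; exact: ww'.
Qed.

Lemma depends_sub s s' A : {subset s <= s'} -> depends s A -> depends s' A.
Proof. by move=> ss' dA w w' ww'; apply: dA => e /ss'; exact: ww'. Qed.

Lemma dependsI s t A B : depends s A -> depends t B -> depends (s ++ t) (A `&` B).
Proof.
move=> dA dB w w' ww' [Aw Bw]; split.
  by apply: dA Aw => e es; apply: ww'; rewrite mem_cat es.
by apply: dB Bw => e es; apply: ww'; rewrite mem_cat es orbT.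
Qed.

Lemma slice_split e A : A =
  ([set w : config | w e = true] `&` slice e true A) `|`
  ([set w : config | w e = false] `&` slice e false A).
Proof.
apply/seteqP; split => [w Aw|w [[/= we]|[/= we]]]; last 2 first.
- by rewrite /slice /= (forceE we).
- by rewrite /slice /= (forceE we).
by case we : (w e); [left|right]; split => //; rewrite /slice /= (forceE we).
Qed.

Lemma measurable_bond e b : measurable [set w : config | w e = b].
Proof. by apply: sub_sigma_algebra; exists e, b. Qed.

Lemma depends_nil A : depends [::] A -> A = set0 \/ A = setT.
Proof.
move=> dA; have [->|/set0P[w Aw]] := eqVneq A set0; first by left.
by right; apply/seteqP; split=> // w' _; apply: dA Aw.
Qed.

Lemma depends_measurable s A : depends s A -> measurable A.
Proof.
elim: s A => [|e s IH] A dA.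
  by case: (depends_nil dA) => ->; [exact: measurable0|exact: measurableT].
rewrite (slice_split e A); apply: measurableU; apply: measurableI;
  by [exact: measurable_bond|apply: IH; exact: depends_slice].
Qed.

Definition cyl (s : seq bond) (b : bond -> bool) : set config :=
  [set w | forall e, e \in s -> w e = b e].

Definition product_law (R : realType) (P : probability config R)
    (q : bond -> R) : Prop :=
  forall (s : seq bond) (b : bond -> bool), uniq s ->
    P (cyl s b) = (\prod_(e <- s) (if b e then q e else 1 - q e))%:E.

Section Probability.
Variables (R : realType) (P : probability config R).

Definition pr (A : set config) : R := fine (P A).

Lemma prE A : measurable A -> P A = (pr A)%:E.
Proof. by move=> mA; rewrite fineK// fin_num_measure. Qed.

Lemma pr_ge0 A : 0 <= pr A.
Proof. exact: fine_ge0. Qed.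

Lemma prT : pr setT = 1.
Proof. by rewrite /pr probability_setT. Qed.

Lemma pr0 : pr set0 = 0.
Proof. by rewrite /pr measure0. Qed.

Lemma pr_le A B : measurable A -> measurable B -> A `<=` B -> pr A <= pr B.
Proof.
by move=> mA mB AB; rewrite -lee_fin -!prE//; apply: le_measure => //; rewrite inE.
Qed.

Lemma prU A B : measurable A -> measurable B -> A `&` B = set0 ->
  pr (A `|` B) = pr A + pr B.
Proof.
move=> mA mB AB; apply: EFin_inj; rewrite EFinD -!prE//; last exact: measurableU.
exact: measureU.
Qed.

Lemma prU_le A B : measurable A -> measurable B -> pr (A `|` B) <= pr A + pr B.
Proof.
move=> mA mB; rewrite -lee_fin EFinD -!prE//; last exact: measurableU.
exact: measureU2.
Qed.

Variable q : bond -> R.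
Hypothesis hP : product_law P q.

Lemma cyl_depends s b : depends s (cyl s b).
Proof. by move=> w w' ww' cw e es; rewrite -ww'//; exact: cw. Qed.

Lemma pr_cyl s b : uniq s ->
  pr (cyl s b) = \prod_(e <- s) (if b e then q e else 1 - q e).
Proof. by move=> us; rewrite /pr hP. Qed.

Lemma cyl_cons e s b c : e \notin s ->
  cyl (e :: s) (force e c b) = [set w : config | w e = c] `&` cyl s b.
Proof.
move=> es; apply/seteqP; split => [w H|w [/= we H] e'].
  split; first by have := H e; rewrite /force eqxx; apply; rewrite mem_head.
  move=> e' e's; have := H e'; rewrite inE e's orbT /force.
  by case: eqP e's es => [-> ->//|_ _ _ ->].
rewrite inE /force; case: eqP => [->//|_ /=]; exact: H.
Qed.

Lemma pr_slice e B A : measurable B -> measurable (slice e true A) ->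
  measurable (slice e false A) ->
  pr (B `&` A) = pr (B `&` [set w : config | w e = true] `&` slice e true A) +
                 pr (B `&` [set w : config | w e = false] `&` slice e false A).
Proof.
move=> mB m1 m0; rewrite {1}(slice_split e A) setIUr prU.
- by rewrite !setIA.
- by apply: measurableI => //; apply: measurableI => //; exact: measurable_bond.
- by apply: measurableI => //; apply: measurableI => //; exact: measurable_bond.
- by apply/seteqP; split=> // w [[_ [/= -> _]] [_ []]].
Qed.

(** Conditioning on one bond of the support of [A] at a time transfers that bond
    to the cylinder; once the support is exhausted, [A] is trivial. *)
Lemma pr_cylI s : forall t b A, depends s A -> uniq t ->
  {in s, forall e, e \notin t} -> pr (cyl t b `&` A) = pr (cyl t b) * pr A.
Proof.
elim: s => [|e s IH] t b A dA ut st.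
  by case: (depends_nil dA) => ->; rewrite ?setI0 ?setIT ?pr0 ?prT ?mulr0 ?mulr1.
have [es|es] := boolP (e \in s).
  apply: IH => //; last by move=> e' e's; apply: st; rewrite inE e's orbT.
  by apply: depends_sub dA => e'; rewrite inE => /orP[/eqP->|].
have et : e \notin t by apply: st; rewrite mem_head.
have dA1 c := depends_slice (b := c) dA.
have H u b' c : uniq u -> {in s, forall e, e \notin u} -> e \notin u ->
    pr (cyl u b' `&` [set w : config | w e = c] `&` slice e c A) =
    pr (cyl u b') * (if c then q e else 1 - q e) * pr (slice e c A).
  move=> uu su eu; rewrite (setIC (cyl _ _)) -(cyl_cons _ _ eu) IH //.
  - have ceu : uniq (e :: u) by rewrite /= eu.
    rewrite (pr_cyl _ ceu) (pr_cyl _ uu) big_cons {1}/force eqxx.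
    rewrite (mulrC _ (\prod_(_ <- _) _)).
    congr (_ * _ * _); apply: eq_big_seq => e' e'u.
    by rewrite /force; case: eqP e'u eu => // -> ->.
  - by rewrite /= eu.
  - move=> e' e's; rewrite inE negb_or su// andbT.
    by apply: contraNneq es => <-.
have pA : pr A = q e * pr (slice e true A) + (1 - q e) * pr (slice e false A).
  have cyl0 : cyl [::] xpredT = setT by apply/seteqP; split.
  rewrite -[A in LHS]setTI -cyl0 (@pr_slice e); last 3 first.
  - exact: depends_measurable (@cyl_depends _ _).
  - exact: depends_measurable (dA1 _).
  - exact: depends_measurable (dA1 _).
  by rewrite !H // cyl0 prT !mul1r.
rewrite (@pr_slice e); last 3 first.
- exact: depends_measurable (@cyl_depends _ _).
- exact: depends_measurable (dA1 _).
- exact: depends_measurable (dA1 _).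
have st' : {in s, forall e, e \notin t} by move=> e' e's; apply: st; rewrite inE e's orbT.
by rewrite !H // pA; ring.
Qed.

(** By induction on the support of [B]: splitting on the state of one of its
    bonds moves that bond to the support of [A]. *)
Lemma pr_indep t : forall s A B, depends s A -> depends t B ->
  {in s, forall e, e \notin t} -> pr (A `&` B) = pr A * pr B.
Proof.
elim: t => [|e t IH] s A B dA dB st.
  by case: (depends_nil dB) => ->; rewrite ?setI0 ?setIT ?pr0 ?prT ?mulr0 ?mulr1.
have [et|et] := boolP (e \in t).
  apply: (IH s) => //; first by apply: depends_sub dB => e'; rewrite inE => /orP[/eqP->|].
  by move=> e' /st; rewrite inE negb_or => /andP[].
have dB1 c := depends_slice (b := c) dB.
have es : e \notin s by apply/negP => /st; rewrite mem_head.
have mA := depends_measurable dA.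
have cyl1 c : [set w : config | w e = c] = cyl [:: e] (fun=> c).
  apply/seteqP; split => [w /= we e'|w /(_ e)]; first by rewrite inE => /eqP->.
  by rewrite mem_head => /(_ isT).
have pe c : pr [set w : config | w e = c] = if c then q e else 1 - q e.
  by rewrite cyl1 pr_cyl// big_seq1.
have H A' s' c : depends s' A' -> {in s', forall e, e \notin t} -> e \notin s' ->
    pr (A' `&` [set w : config | w e = c] `&` slice e c B) =
    pr A' * (if c then q e else 1 - q e) * pr (slice e c B).
  move=> dA' s't es'; rewrite (IH (s' ++ [:: e])) //.
  - rewrite setIC cyl1 (@pr_cylI s') //; last first.
      by move=> e' e's; rewrite inE; apply: contraNneq es' => <-.
    by rewrite -cyl1 pe (mulrC (pr A')).
  - by apply: dependsI => //; rewrite cyl1; exact: cyl_depends.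
  - by move=> e'; rewrite mem_cat => /orP[/s't//|]; rewrite inE => /eqP->.
have st' : {in s, forall e, e \notin t}.
  by move=> e' /st; rewrite inE negb_or => /andP[].
have mB1 c := depends_measurable (dB1 c).
rewrite (@pr_slice e) // !(H A s) // -[B in RHS]setTI (@pr_slice e) //.
by rewrite !(H setT [::]) // prT; ring.
Qed.
End Probability.

Section UnionBounds.
Variables (R : realType) (P : probability config R).

Lemma ex_cons (I : eqType) (i : I) (s : seq I) (A : I -> set config) :
  [set w | exists2 j, j \in i :: s & A j w] =
  A i `|` [set w | exists2 j, j \in s & A j w].
Proof.
apply/seteqP; split => [w [j]|w [Aw|[j js Aw]]].
- by rewrite inE => /orP[/eqP->|js Aw]; [left|right; exists j].
- by exists i => //; rewrite mem_head.
- by exists j => //; rewrite inE js orbT.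
Qed.

Lemma ex_nil (I : eqType) (A : I -> set config) :
  [set w | exists2 j, j \in [::] & A j w] = set0.
Proof. by apply/seteqP; split => // w []. Qed.

Lemma measurable_ex (I : eqType) (s : seq I) (A : I -> set config) :
  (forall i, measurable (A i)) ->
  measurable [set w | exists2 i, i \in s & A i w].
Proof.
move=> mA; elim: s => [|i s IH]; first by rewrite ex_nil; exact: measurable0.
by rewrite ex_cons; exact: measurableU.
Qed.

Lemma pr_ex_le (I : eqType) (s : seq I) (A : I -> set config) :
  (forall i, measurable (A i)) ->
  pr P [set w | exists2 i, i \in s & A i w] <= \sum_(i <- s) pr P (A i).
Proof.
move=> mA; elim: s => [|i s IH]; first by rewrite ex_nil big_nil pr0.
rewrite big_cons ex_cons.
apply: le_trans (prU_le _ _ _) _ => //; first exact: measurable_ex.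
by rewrite lerD2l.
Qed.

Lemma pr_bigcup_geometric (B : nat -> set config) (r : R) :
  (forall n, measurable (B n)) -> (forall n, pr P (B n) <= r / 2 ^+ n) ->
  pr P (\bigcup_n B n) <= 2 * r.
Proof.
move=> mB Br.
have mU : measurable (\bigcup_n B n) by apply: bigcupT_measurable.
rewrite -lee_fin -prE//.
apply: le_trans (@measure_sigma_subadditive _ _ _ P _ B _ _ _) _ => //.
have /cvg_lim := @cvg_geometric_eseries_half R (2 * r) 0.
rewrite expr0 divr1 => <- //; apply: lee_nneseries => n // _.
apply: (@le_trans _ _ (pr P (B n))%:E); first by rewrite -prE.
rewrite lee_fin (le_trans (Br n))// addn1 expnS natrM.
by rewrite -mulf_div divff ?mul1r// natrX.
Qed.

End UnionBounds.

(** * Blocks of the percolation graph *)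

Section Geometry.
Variables (N M L : nat) (T : seq nat).
Hypothesis N0 : (0 < N)%N.
Hypothesis TL : {in T, forall m, (m + N < L)%N}.

(** Only the columns whose abscissa is a multiple of [N] are used. *)
Definition vertex (k j : nat) : site := ((k * N)%:Z, j%:Z).

(** A step of length [m + 1 + N] to the right followed by one of length [m + 1]
    to the left is a net step of length [N], from [vertex k j] to
    [vertex k.+1 j]; its probability is the summand of the hypothesis. *)
Definition detour (m k j : nat) (w : bond -> bool) : bool :=
  w (Hbond (m + N) (vertex k j)) && w (Hbond m (vertex k.+1 j)).

Definition linked (k j : nat) (w : bond -> bool) : bool :=
  has (fun m => detour m k j w) T.

(** The [M] consecutive links make the block connected from its left end to the
    left end of the next one; the vertical bond leads to the block above.  Small
    [delta] is compensated by large [M]. *)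
Definition good_block (w : bond -> bool) (c : cell) : bool :=
  all (fun i => linked (c.1 * M + i) c.2 w) (iota 0 M) &&
  has (fun i => w (Vbond (vertex (c.1 * M + i) c.2))) (iota 0 M).

(** Restricting to bonds of bounded length makes the graph locally finite. *)
Definition short (b : bond) : bool := if b is Hbond m _ then (m < L)%N else true.

Definition open_edge (w : bond -> bool) : rel site :=
  fun x y => `[< exists2 b, joins b x y & w b && short b >].

Lemma open_edge_sym w : symmetric (open_edge w).
Proof.
by move=> x y; apply/asboolP/asboolP => -[b [] jb wb]; exists b => //;
  [right|left|right|left].
Qed.

Definition neighbours (x : site) : seq site :=
  [:: (x.1, x.2 + 1); (x.1, x.2 - 1)] ++
  [seq (x.1 + m.+1%:Z, x.2) | m <- iota 0 L] ++
  [seq (x.1 - m.+1%:Z, x.2) | m <- iota 0 L].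

Lemma open_edge_neighbours w x y : open_edge w x y -> y \in neighbours x.
Proof.
move=> /asboolP[[v|m v]] [] /= [<- <-] /andP[_ /= mL]; rewrite !mem_cat !inE /=.
- by rewrite eqxx.
- by rewrite addrK -surjective_pairing eqxx orbT.
- apply/orP; right; apply/orP; left; apply/mapP; exists m => //.
  by rewrite mem_iota.
- apply/orP; right; apply/orP; right; apply/mapP; exists m.
    by rewrite mem_iota.
  by rewrite addrK -surjective_pairing.
Qed.

Lemma linked_reach w k j :
  linked k j w -> reach (open_edge w) (vertex k j) (vertex k.+1 j).
Proof.
move=> /hasP[m mT /andP[w1 w2]]; have mL := TL mT.
pose x : site := ((k * N)%:Z + (m + N).+1%:Z, j%:Z).
apply: (@reach_trans _ _ _ x); apply: reach_edge; apply/asboolP.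
  by exists (Hbond (m + N) (vertex k j)); [left|rewrite w1].
exists (Hbond m (vertex k.+1 j)); last by rewrite w2 /= (leq_ltn_trans _ mL) ?leq_addr.
by right; split => //=; congr pair; lia.
Qed.

Lemma good_block_reach w c i : good_block w c -> (i <= M)%N ->
  reach (open_edge w) (vertex (c.1 * M) c.2) (vertex (c.1 * M + i) c.2).
Proof.
move=> /andP[/allP lk _]; elim: i => [_|i IH iM].
  by rewrite addn0; exact: reach_refl.
apply: reach_trans (IH (ltnW iM)) _; rewrite addnS.
by apply: linked_reach; apply: lk; rewrite mem_iota.
Qed.

Lemma good_block_adj w c d : good_block w c -> good_block w d -> adj c d ->
  reach (open_edge w) (vertex (c.1 * M) c.2) (vertex (d.1 * M) d.2).
Proof.
move=> gc gd /adjE[dE|dE].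
  by rewrite dE mulSnr; exact: good_block_reach.
have /andP[_ /hasP[i]] := gc; rewrite mem_iota => /= iM wi.
apply: reach_trans (good_block_reach gc (ltnW iM)) _.
apply: (@reach_trans _ _ _ (vertex (d.1 * M + i) d.2)); last first.
  apply: reach_sym; first exact: open_edge_sym.
  exact: good_block_reach gd (ltnW iM).
apply: reach_edge; apply/asboolP.
exists (Vbond (vertex (c.1 * M + i) c.2)); last by rewrite wi.
by left; split=> //; rewrite dE /vertex /=; congr pair; lia.
Qed.

(** The deterministic half of the theorem: goodness at all scales around the
    origin gives it an infinite cluster in a locally finite graph, hence an
    infinite self-avoiding open path. *)
Lemma good_percolates (w : config) :
  (forall n, good (good_block w) n (0, 0)%N) -> percolates w.
Proof.
move=> gw.
have M0 : (0 < M)%N.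
  by have /= /andP[_] := gw 0%N; case: (M).
have unb := @good_unbounded (good_block w)
  (fun c d => reach (open_edge w) (vertex (c.1 * M) c.2) (vertex (d.1 * M) d.2))
  (fun c => reach_refl _ _) (fun c d => reach_sym (open_edge_sym w))
  (fun d c c' => @reach_trans _ _ _ _ _) (@good_block_adj w) gw.
have inf : infinite_set [set y | reach (open_edge w) origin y].
  move=> /finite_seqP[s sE].
  have [c rc cB] := unb (\max_(y <- s) `|y.1|%N).+1.
  have cs : vertex (c.1 * M) c.2 \in s.
    have : [set y | reach (open_edge w) origin y] (vertex (c.1 * M) c.2) by exact: rc.
    by rewrite sE.
  have := @leq_bigmax_seq _ s xpredT (fun y : site => `|y.1|%N) _ cs isT.
  rewrite /=; move: cB; set B := (\max_(_ <- _) _)%N => cB cB'.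
  have := leq_ltn_trans cB' cB; rewrite ltnNge => /negP; apply.
  rewrite -mulnA leq_pmulr//.
  by rewrite muln_gt0 M0.
have [f [f0 fI fS]] := koenig (@open_edge_neighbours w) inf.
exists f; split => // k; have /asboolP[b jb /andP[wb _]] := fS k.
by exists b.
Qed.
End Geometry.

(** * Bonds read by a cell *)

Section Supports.
Variables (N M : nat) (T : seq nat).
Hypothesis N0 : (0 < N)%N.
Hypothesis TN : {in T, forall m, (m + N)%N \notin T}.

Definition detour_bonds (m k j : nat) : seq bond :=
  [:: Hbond (m + N) (vertex N k j); Hbond m (vertex N k.+1 j)].

Definition linked_bonds (k j : nat) : seq bond :=
  flatten [seq detour_bonds m k j | m <- T].

Definition column_bonds (k j : nat) : seq bond :=
  Vbond (vertex N k j) :: linked_bonds k j.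

Definition block_bonds (c : cell) : seq bond :=
  flatten [seq column_bonds (c.1 * M + i) c.2 | i <- iota 0 M].

Fixpoint level_bonds (n : nat) (c : cell) : seq bond :=
  if n is n'.+1 then flatten [seq level_bonds n' (subcell c d) | d <- offsets]
  else block_bonds c.

Lemma vertex_inj k j k' j' : vertex N k j = vertex N k' j' -> k = k' /\ j = j'.
Proof.
by case=> /eqP; rewrite eqn_pmul2r// => /eqP -> ->.
Qed.

Lemma Vbond_vertex_inj k j k' j' :
  Vbond (vertex N k j) = Vbond (vertex N k' j') -> k = k' /\ j = j'.
Proof. by move=> E; have := congr1 bond_start E; exact: vertex_inj. Qed.

Lemma Hbond_vertex_inj m k j m' k' j' :
  Hbond m (vertex N k j) = Hbond m' (vertex N k' j') ->
  [/\ m = m', k = k' & j = j'].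
Proof.
move=> E; have [-> ->] := vertex_inj (congr1 bond_start E).
by case: E => ->.
Qed.

(** The bond [Hbond m (vertex k j)] could serve the link starting at [k], as a
    long step, and the link ending at [k], as a short one.  Since [T] and its
    translate by [N] are disjoint it serves at most one, so that distinct columns
    read disjoint sets of bonds. *)
Lemma column_bonds_inj e k j k' j' :
  e \in column_bonds k j -> e \in column_bonds k' j' -> k = k' /\ j = j'.
Proof.
rewrite !inE => /orP[/eqP->|].
  move=> /orP[/eqP/Vbond_vertex_inj//|/flatten_mapP[m _]].
  by rewrite !inE => /orP[]/eqP.
move=> /flatten_mapP[m mT]; rewrite !inE => em /orP[/eqP eV|/flatten_mapP[m' m'T]].
  by move: em; rewrite eV => /orP[]/eqP.
rewrite !inE; case/orP: em => /eqP -> /orP[]/eqP/Hbond_vertex_inj[].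
- by [].
- by move=> E; move: m'T; rewrite -E (negbTE (TN mT)).
- by move=> E; move: mT; rewrite E (negbTE (TN m'T)).
- by move=> _ [].
Qed.

Lemma block_bonds_inj e c c' :
  e \in block_bonds c -> e \in block_bonds c' -> c = c'.
Proof.
move=> /flatten_mapP[i]; rewrite mem_iota => /= iM ei.
move=> /flatten_mapP[i']; rewrite mem_iota => /= i'M ei'.
have [E1 E2] := column_bonds_inj ei ei'.
rewrite (surjective_pairing c) (surjective_pairing c') E2; congr pair.
have := congr1 (divn^~ M) E1; rewrite /= !divnMDl ?(leq_ltn_trans _ iM)//.
by rewrite !divn_small// !addn0.
Qed.

Lemma level_bonds_inj n e c c' :
  e \in level_bonds n c -> e \in level_bonds n c' -> c = c'.
Proof.
elim: n c c' => [|n IH] c c'; first exact: block_bonds_inj.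
move=> /flatten_mapP[d dof ed] /flatten_mapP[d' d'of ed'].
have off d0 : d0 \in offsets -> (d0.1 < 3)%N && (d0.2 < 3)%N.
  by apply/allP: d0.
have /andP[d1 d2] := off _ dof; have /andP[d'1 d'2] := off _ d'of.
case: c c' d d' {dof d'of} d1 d2 d'1 d'2 ed ed' => [x y] [x' y'] [i j] [i' j'].
move=> /= d1 d2 d'1 d'2 ed ed'; have [E1 E2] := IH _ _ ed ed'.
by congr pair; clear -d1 d2 d'1 d'2 E1 E2; lia.
Qed.

Lemma good_block_local c (w w' : bond -> bool) :
  {in block_bonds c, w =1 w'} -> good_block N M T w c = good_block N M T w' c.
Proof.
move=> ww'.
have col i e : i \in iota 0 M -> e \in column_bonds (c.1 * M + i) c.2 -> w e = w' e.
  by move=> iM ec; apply: ww'; apply/flatten_mapP; exists i.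
congr (_ && _).
  apply: eq_in_all => i iM; apply: eq_in_has => m mT; congr (_ && _);
    apply: (col i) => //; rewrite inE; apply/orP; right; apply/flatten_mapP;
    by exists m => //; rewrite !inE eqxx ?orbT.
by apply: eq_in_has => i iM; apply: (col i) => //; rewrite mem_head.
Qed.

Lemma good_local n c (w w' : bond -> bool) :
  {in level_bonds n c, w =1 w'} ->
  good (good_block N M T w) n c = good (good_block N M T w') n c.
Proof.
elim: n c => [|n IH] c ww'; first exact: good_block_local.
rewrite !goodS; congr (_ <= _)%N; apply: eq_in_count => d dof; congr (~~ _).
by apply: IH => e ed; apply: ww'; apply/flatten_mapP; exists d.
Qed.

Definition bad_event (n : nat) (c : cell) : set config :=
  [set w | ~~ good (good_block N M T w) n c].

Lemma bad_event_depends n c : depends (level_bonds n c) (bad_event n c).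
Proof. by move=> w w' ww'; rewrite /bad_event /= (good_local ww'). Qed.

Definition unlinked (S : seq nat) (k j : nat) : set config :=
  [set w | ~~ linked N S k j w].

End Supports.

(** * Probability of bad cells *)

Section Bounds.
Variables (R : realType) (P : probability config R) (q : bond -> R).
Hypothesis hP : product_law P q.
Variables (N M L : nat) (T : seq nat) (delta : R) (a : nat -> R).
Hypothesis N0 : (0 < N)%N.
Hypothesis TN : {in T, forall m, (m + N)%N \notin T}.
Hypothesis uT : uniq T.
Hypothesis TL : {in T, forall m, (m + N < L)%N}.
Hypothesis qV : forall x, q (Vbond x) = delta.
Hypothesis qH : forall m x, (m < L)%N -> q (Hbond m x) = a m.

Lemma unlinked_depends S k j : depends (linked_bonds N S k j) (unlinked N S k j).
Proof.
move=> w w' ww'; rewrite /unlinked /linked /=.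
rewrite (@eq_in_has _ _ (fun m => detour N m k j w')) //.
move=> m mS; congr (_ && _); apply: ww'; apply/flatten_mapP;
  by exists m => //; rewrite !inE eqxx ?orbT.
Qed.

(** The detours of a link use disjoint pairs of bonds, so they fail
    independently. *)
Lemma pr_unlinked k j :
  pr P (unlinked N T k j) = \prod_(m <- T) (1 - a m * a (m + N)%N).
Proof.
suff gen S : uniq S -> {subset S <= T} ->
    pr P (unlinked N S k j) = \prod_(m <- S) (1 - a m * a (m + N)%N).
  exact: gen.
elim: S => [|m S IH] /= => [_ _|/andP[mS uS] ST].
  by rewrite big_nil -(prT P); congr pr; apply/seteqP; split.
pose D := [set w : config | ~~ detour N m k j w].
have mT : m \in T by apply: ST; rewrite mem_head.
have mNL := TL mT; have mL : (m < L)%N by apply: leq_ltn_trans mNL; rewrite leq_addr.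
have dD : depends (detour_bonds N m k j) D.
  by move=> w w' ww'; rewrite /D /= /detour !ww' // !inE eqxx ?orbT.
rewrite (_ : unlinked _ _ _ _ = unlinked N S k j `&` D); last first.
  apply/seteqP; split=> w; rewrite /unlinked /D /= negb_or.
    by move=> /andP[].
  by move=> [-> ->].
rewrite (pr_indep hP (@unlinked_depends _ _ _) dD); last first.
  move=> e /flatten_mapP[m' m'S]; rewrite !inE negb_or.
  have mm' : m != m' by apply: contraNneq mS => ->.
  move=> /orP[]/eqP->; apply/andP; split; apply/eqP => /(Hbond_vertex_inj N0)[].
  - by move=> /addIn E; rewrite E eqxx in mm'.
  - by move=> _ /eqP; clear; lia.
  - by move=> _ /eqP; clear; lia.
  - by move=> E; rewrite E eqxx in mm'.
rewrite big_cons mulrC IH//; last by move=> x xS; apply: ST; rewrite inE xS orbT.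
congr (_ * _).
have -> : D = ~` cyl (detour_bonds N m k j) xpredT.
  apply/seteqP; split=> w; rewrite /D /cyl /detour /=.
    by move=> /negP H H'; apply: H; rewrite !H' // !inE eqxx ?orbT.
  move=> H; apply/negP => /andP[w1 w2]; apply: H => e.
  by rewrite !inE => /orP[]/eqP->.
have mc : measurable (cyl (detour_bonds N m k j) xpredT).
  exact: depends_measurable (@cyl_depends _ _).
have := prU P mc (measurableC mc) (setICr _).
rewrite setUCr prT (pr_cyl hP); last first.
  rewrite /= inE andbT; apply/eqP => /(Hbond_vertex_inj N0)[_ /eqP]; clear; lia.
rewrite !big_cons big_nil mulr1 !qH// => E; rewrite mulrC.
by apply/eqP; rewrite eq_sym subr_eq addrC -E.
Qed.

(** A union bound over the [M] links, plus the event that all the [M] vertical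
    bonds are closed. *)
Lemma pr_bad_block c : pr P (bad_event N M T 0 c) <=
  M%:R * \prod_(m <- T) (1 - a m * a (m + N)%N) + (1 - delta) ^+ M.
Proof.
pose A i := unlinked N T (c.1 * M + i) c.2.
have mA i : measurable (A i) by apply: depends_measurable (@unlinked_depends _ _ _).
pose rungs := [seq Vbond (vertex N (c.1 * M + i) c.2) | i <- iota 0 M].
have urungs : uniq rungs.
  rewrite map_inj_in_uniq ?iota_uniq// => i i' _ _ [] /eqP.
  by rewrite eqn_pmul2r // eqn_add2l => /eqP.
have mR : measurable (cyl rungs xpred0).
  exact: depends_measurable (@cyl_depends _ _).
have mU := measurable_ex (iota 0 M) mA.
have sub : bad_event N M T 0 c `<=`
    [set w | exists2 i, i \in iota 0 M & A i w] `|` cyl rungs xpred0.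
  move=> w; rewrite /bad_event /= negb_and => /orP[/allPn[i iM li]|nr].
    by left; exists i.
  right => e /mapP[i iM ->]; apply/negbTE.
  by move: nr => /hasPn/(_ i iM).
have mB : measurable (bad_event N M T 0 c).
  exact: depends_measurable (@bad_event_depends _ _ _ _ _).
apply: le_trans (pr_le P mB (measurableU _ _ mU mR) sub) _.
apply: le_trans (prU_le P mU mR) _; apply: lerD.
  apply: le_trans (pr_ex_le P (iota 0 M) mA) _.
  rewrite (eq_bigr _ (fun i _ => pr_unlinked (c.1 * M + i) c.2)).
  by rewrite big_const_seq count_predT size_iota iter_addr_0 mulr_natl.
rewrite (pr_cyl hP) // big_map.
under eq_bigr => i _ do rewrite qV.
by rewrite big_const_seq count_predT size_iota -/(iter _ _ _) iter_mulr_1.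
Qed.

Variable eta : R.
(* 162 = 2 * 81, where 81 bounds the number of pairs of distinct subcells. *)
Hypothesis eta_small : 162 * eta <= 1.
Hypothesis bad_block_eta :
  M%:R * \prod_(m <- T) (1 - a m * a (m + N)%N) + (1 - delta) ^+ M <= eta.

(** A bad cell has two bad subcells, which are independent, so badness [x] at one
    level becomes at most [81 * x ^ 2] at the next; below the threshold
    [1 / 162] this at least halves it. *)
Lemma pr_bad n c : pr P (bad_event N M T n c) <= eta / 2 ^+ n.
Proof.
elim: n c => [|n IH] c.
  by rewrite expr0 divr1; exact: le_trans (pr_bad_block c) bad_block_eta.
have mB n' c' : measurable (bad_event N M T n' c').
  exact: depends_measurable (@bad_event_depends _ _ _ _ _).
pose pairs := [seq dd <- [seq (d, d') | d <- offsets, d' <- offsets] | dd.1 != dd.2].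
pose A (dd : cell * cell) :=
  bad_event N M T n (subcell c dd.1) `&` bad_event N M T n (subcell c dd.2).
have mA dd : measurable (A dd) by apply: measurableI.
have e0 : 0 <= eta / 2 ^+ n by apply: le_trans (IH c); exact: pr_ge0.
have sub : bad_event N M T n.+1 c `<=` [set w | exists2 i, i \in pairs & A i w].
  move=> w /bad_pair[d [d' [dof d'of dd' bd bd']]]; exists (d, d') => //.
  rewrite mem_filter; apply/andP; split=> //.
  by apply/allpairsP; exists (d, d').
apply: le_trans (pr_le P (mB _ _) (measurable_ex pairs mA) sub) _.
apply: le_trans (pr_ex_le P pairs mA) _.
apply: (@le_trans _ _ (\sum_(dd <- pairs) (eta / 2 ^+ n) ^+ 2)).
  rewrite big_seq [leRHS]big_seq; apply: ler_sum => -[d d'].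
  rewrite mem_filter /= => /andP[dd' _].
  rewrite /A /= (pr_indep hP (@bad_event_depends _ _ _ _ _)
    (@bad_event_depends _ _ _ _ _)).
    by rewrite expr2 ler_pM// ?pr_ge0.
  move=> e e1; apply/negP => e2.
  have [E1 E2] := level_bonds_inj N0 TN e1 e2; move: dd' => /eqP; apply.
  by case: d d' {e1 e2} E1 E2 => [x y] [x' y'] /= E1 E2; congr pair; clear -E1 E2; lia.
rewrite big_const_seq iter_addr_0 count_predT.
apply: (@le_trans _ _ ((eta / 2 ^+ n) ^+ 2 *+ 81)).
  apply: ler_wpMn2l; first by rewrite exprn_ge0.
  by rewrite size_filter (leq_trans (count_size _ _)).
rewrite -mulr_natr [X in _ <= eta / X]exprSr invfM mulrA.
have h2 : (2 ^+ n)^-1 <= 1 :> R by rewrite invf_le1 ?exprn_gt0// exprn_ege1 // ler1n.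
have h3 : 0 <= (2 ^+ n)^-1 :> R by rewrite invr_ge0 exprn_ge0.
have e1 : eta / 2 ^+ n <= eta.
  have eta0 : 0 <= eta by move: e0; rewrite pmulr_lge0// invr_gt0 exprn_gt0.
  by rewrite ler_piMr.
move: e0 e1; set x := eta / 2 ^+ n => e0 e1.
have : x * x <= x * eta by rewrite ler_wpM2l.
have : x * (162 * eta) <= x * 1 by rewrite ler_wpM2l.
rewrite expr2; lra.
Qed.

(** The completed probability of a set is its outer measure, so it is bounded
    below by the probability of any event contained in the set. *)
Lemma percolation_lower_bound :
  ((1 - 2 * eta)%:E <= completed_prob P percolates)%E.
Proof.
pose B n := bad_event N M T n (0, 0)%N.
have mB n : measurable (B n).
  exact: depends_measurable (@bad_event_depends _ _ _ _ _).
have mU : measurable (\bigcup_n B n) by apply: bigcupT_measurable.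
have sub : ~` (\bigcup_n B n) `<=` percolates.
  move=> w nB; apply: (good_percolates (M := M) N0 TL) => n.
  by apply: contraT => bn; case: nB; exists n.
have mUC : measurable (~` (\bigcup_n B n)) by apply: measurableC.
apply: (@le_trans _ _ (P (~` (\bigcup_n B n)))); last first.
  rewrite -(measurable_mu_extE P mUC).
  exact: (le_outer_measure (P^*)%mu).
rewrite prE//.
rewrite lee_fin.
have := prU P mU (measurableC mU) (setICr _); rewrite setUCr prT.
have := pr_bigcup_geometric mB (fun n => pr_bad n (0, 0)%N).
by rewrite /=; lra.
Qed.
End Bounds.

(** * Divergence of the series and the limit *)

(** Each factor trades off against the sum:
    [(1 - x) * (1 + (x + S)) = 1 + S - x * (S + x) <= 1 + S]. *)
Lemma prod_1sub_le (R : realFieldType) (I : Type) (s : seq I) (x : I -> R) :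
  (forall i, 0 <= x i <= 1) ->
  \prod_(i <- s) (1 - x i) <= (1 + \sum_(i <- s) x i)^-1.
Proof.
move=> x01.
have x0 i : 0 <= x i by have /andP[] := x01 i.
have x1 i : 0 <= 1 - x i by have /andP[] := x01 i; rewrite subr_ge0.
rewrite -[leRHS]mul1r ler_pdivlMr ?ltr_pwDl ?ltr01 ?sumr_ge0//.
elim: s => [|i s]; first by rewrite !big_nil addr0 mulr1.
rewrite !big_cons.
have : 0 <= \prod_(i <- s) (1 - x i) by rewrite prodr_ge0.
have : 0 <= \sum_(i <- s) x i by rewrite sumr_ge0.
set S := \sum_(_ <- _) _; set Q := \prod_(_ <- _) _ => S0 Q0 H.
have : 0 <= Q * (x i * (S + x i)) by rewrite !mulr_ge0// addr_ge0.
rewrite (_ : _ * Q * _ = Q * (1 + S) - Q * (x i * (S + x i))); last by ring.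
by lra.
Qed.

Lemma partial_sum_large (R : realType) (f : nat -> R) (B : R) :
  (forall n, (1 <= n)%N -> 0 <= f n) ->
  (\sum_(1 <= n <oo) (f n)%:E)%E = +oo%E ->
  exists L, B <= \sum_(m <- iota 0 L) f m.+1.
Proof.
move=> f0 finf; apply: contrapT => noL.
have : (\sum_(1 <= n <oo) (f n)%:E <= B%:E)%E.
  apply: lime_le.
    by apply: is_cvg_nneseries => n n1 _; rewrite lee_fin f0.
  apply: nearW => -[|L]; rewrite sumEFin lee_fin.
    rewrite big_geq// leNgt; apply/negP => B0; apply: noL; exists 0%N.
    by rewrite big_nil ltW.
  rewrite big_add1 /= /index_iota subn0 leNgt; apply/negP => BL; apply: noL.
  by exists L; exact: ltW.
by rewrite finf leye_eq.
Qed.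

(** Sorting lengths by the parity of [m %/ N] separates [m] from [m + N], and
    one of the two classes carries half of the sum. *)
Lemma sparse_lengths (R : realType) (f : nat -> R) (N L : nat) (B : R) :
  (0 < N)%N -> 2 * B <= \sum_(m <- iota 0 L) f m ->
  exists T : seq nat, [/\ uniq T, {in T, forall m, (m < L)%N},
    {in T, forall m, (m + N)%N \notin T} & B <= \sum_(m <- T) f m].
Proof.
move=> N0 BL.
pose T c := [seq m <- iota 0 L | odd (m %/ N) == c].
have good_T c : B <= \sum_(m <- T c) f m ->
    exists T : seq nat, [/\ uniq T, {in T, forall m, (m < L)%N},
    {in T, forall m, (m + N)%N \notin T} & B <= \sum_(m <- T) f m].
  move=> BT; exists (T c); split => //.
  - by rewrite filter_uniq// iota_uniq.
  - by move=> m; rewrite mem_filter mem_iota => /andP[].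
  - move=> m; rewrite !mem_filter => /andP[/eqP mc _].
    by rewrite divnDr ?dvdnn// divnn N0 addn1 /= mc; case: (c).
have split_sum : \sum_(m <- iota 0 L) f m =
    \sum_(m <- T true) f m + \sum_(m <- T false) f m.
  rewrite !big_filter (bigID (fun m => odd (m %/ N) == true)) /=; congr (_ + _).
  by apply: eq_bigl => m; case: odd.
move: BL; rewrite split_sum => BL; have [|B1] := leP B (\sum_(i <- T true) f i); first exact: good_T.
by apply: (good_T false); lra.
Qed.

Lemma completed_prob_le1 (R : realType) (P : probability config R) A :
  (completed_prob P A <= 1)%E.
Proof.
rewrite -(@probability_setT _ _ _ P) -(measurable_mu_extE P measurableT).
exact: (le_outer_measure (P^*)%mu).
Qed.

Lemma exists_small_power (R : realType) (x e : R) : 0 <= x < 1 -> 0 < e ->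
  exists M, x ^+ M <= e.
Proof.
move=> /andP[x0 x1] e0.
have /cvgrPdist_le /(_ _ e0) : (fun n => x ^+ n) @ \oo --> (0 : R).
  by apply: cvg_expr; rewrite ger0_norm.
case=> M _ /(_ M (leqnn M)); rewrite /= sub0r normrN => H; exists M.
exact: le_trans (ler_norm _) H.
Qed.

Theorem theorem1 (R : realType) (delta : R) (p : nat -> R)
    (P : nat -> probability config R)
    (hdelta : 0 < delta <= 1)
    (hp : forall n : nat, (1 <= n)%N -> 0 <= p n <= 1)
    (hP : forall K : nat, (1 <= K)%N ->
       percolation_measure delta (truncation K p) (P K))
    (hsum : exists N : nat, (0 < N)%N /\
       (\sum_(1 <= n <oo) (p n * p (n + N)%N)%:E)%E = +oo%E) :
  (fun K : nat => completed_prob (P K) percolates) @ \oo --> 1%E.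
Proof.
have [N [N0 sumN]] := hsum; have /andP[d0 d1] := hdelta.
have lower (e : R) : 0 < e ->
    \forall K \near \oo, ((1 - e)%:E <= completed_prob (P K) percolates)%E.
  move=> e0; pose eta := Num.min (e / 2) (162^-1).
  have eta0 : 0 < eta by rewrite lt_min divr_gt0//= invr_gt0.
  have eta1 : 162 * eta <= 1.
    have : eta <= 162^-1 by rewrite ge_min lexx orbT.
    lra.
  have eta2 : 2 * eta <= e.
    have : eta <= e / 2 by rewrite ge_min lexx.
    lra.
  have eta20 : 0 < eta / 2 by rewrite divr_gt0.
  have [M Meta] : exists M, (1 - delta) ^+ M <= eta / 2.
    by apply: exists_small_power => //; lra.
  (* [B] is such that [M / (1 + B) <= eta / 2]. *)
  pose B : R := 2 * M%:R / eta.
  have B0 : 0 <= B by rewrite divr_ge0 ?mulr_ge0// ltW.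
  (* Horizontal bonds are indexed by their length minus one. *)
  pose a m := p m.+1.
  have a01 m : 0 <= a m <= 1 by apply: hp.
  have [L BL] : exists L, 2 * B <= \sum_(m <- iota 0 L) a m * a (m + N)%N.
    apply: (partial_sum_large (f := fun n => p n * p (n + N)%N)) sumN => n n1.
    have /andP[h1 _] := hp n n1; have /andP[h2 _] := hp (n + N)%N (ltn_addr _ n1).
    by rewrite mulr_ge0.
  have [T [uT TL TN BT]] := sparse_lengths N0 BL.
  exists (L + N)%N => // K /= LK.
  have K1 : (1 <= K)%N by apply: leq_trans LK; rewrite addn_gt0 N0 orbT.
  have LNT : {in T, forall m, (m + N < L + N)%N} by move=> m /TL; rewrite ltn_add2r.
  apply: (@le_trans _ _ (1 - 2 * eta)%:E); first by rewrite lee_fin; lra.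
  apply: (@percolation_lower_bound R (P K) (bond_prob delta (truncation K p))
    (hP K K1) N M (L + N)%N T delta a) => //.
    by move=> m x mL; rewrite /= /truncation (leq_trans mL LK).
  have x01 m : 0 <= a m * a (m + N)%N <= 1.
    have /andP[h1 h2] := a01 m; have /andP[h3 h4] := a01 (m + N)%N.
    by rewrite mulr_ge0// mulr_ile1.
  move: BT; have := prod_1sub_le T x01.
  set S := \sum_(_ <- _) _; set Q := \prod_(_ <- _) _ => QS BT.
  suff : M%:R * Q <= eta / 2 by lra.
  have S0 : 0 < 1 + S by rewrite ltr_pwDl// (le_trans B0 BT).
  apply: le_trans (ler_wpM2l _ QS) _ => //.
  rewrite ler_pdivrMr//.
  have <- : eta / 2 * B = M%:R by rewrite /B; field; rewrite gt_eqF.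
  by rewrite ler_pM2l// (le_trans BT)// lerDr.
apply/fine_cvgP; split.
  have := lower 1 ltr01; apply: filterS => K; rewrite subrr => h.
  by rewrite ge0_fin_numE// (le_lt_trans (completed_prob_le1 _ _))// ltry.
apply/cvgrPdist_le => e e0; near=> K.
have h0 : ((1 - e)%:E <= completed_prob (P K) percolates)%E.
  by near: K; exact: lower.
(* Excludes the value -oo in the case analysis below. *)
have h0' : ((1 - 1)%:E <= completed_prob (P K) percolates)%E.
  by near: K; exact: lower.
have h1 := completed_prob_le1 (P K) percolates.
move: h0 h0' h1 => /=; case: completed_prob => [r| |] //; rewrite !lee_fin /=.
by move=> h0 h0' h1; rewrite ger0_norm; lra.
Unshelve. all: by end_near.
Qed.
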